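(* Let $\phi,\psi$ be cyclic formulas both modalised in $p$. If $\mathsf{CHL}\vdash\phi\leftrightarrow\psi$, then $\mathsf{CHL}\vdash\digamma p.\phi\leftrightarrow\digamma p.\psi$.
   Context: Labels: $\bot,\top$ and propositional variables (arity 0), $\neg,\Box$ (arity 1), $\wedge,\vee,\to$ (arity 2). A graph is $\langle V,r,S,\lambda\rangle$ with $V$ finite, root $r$, labelling $\lambda$, $S:V\to V^{*}$ ordered successors (length = arity of label); every vertex reachable from $r$. A (cyclic) formula is a graph in which every cycle (closed path of pairwise distinct vertices along successors) contains a $\Box$-labelled vertex. Bisimulation: $aRa'$ implies equal labels and $i$-th successors related; $\simeq$ = bisimilarity relating roots. $\phi$ modalised in $p$: every path from root to a $p$-labelled vertex contains a $\Box$-labelled vertex; then $\digamma p.\phi$ identifies the root with all $p$-labelled vertices (keeping the root's label). $\mathsf{CHL}$: least set of cyclic formulas containing all substitution instances of propositional tautologies, all $\Box(\phi\to\psi)\to(\Box\phi\to\Box\psi)$, all $\phi\leftrightarrow\psi$ with $\phi\simeq\psi$, closed under modus ponens, necessitation and Löb's rule (from $\vdash\Box\phi\to\phi$ infer $\vdash\phi$). *)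

(* Defs.v *)
From HB Require Import structures.
From mathcomp Require Import all_boot.
Set Implicit Arguments.
Unset Strict Implicit.
Unset Printing Implicit Defensive.

Inductive label : Type :=
  | LBot | LTop | LVar of nat | LNeg | LBox | LAnd | LOr | LImp.

Definition arity (l : label) : nat :=
  match l with
  | LBot | LTop | LVar _ => 0
  | LNeg | LBox => 1
  | LAnd | LOr | LImp => 2
  end.

Lemma label_eq_dec (l m : label) : {l = m} + {l <> m}.
Proof. by decide equality; apply: eq_comparable. Defined.

HB.instance Definition _ := hasDecEq.Build label (compareP label_eq_dec).

Record graph : Type := Graph {
  vertex :> finType;
  root : vertex;
  succ : vertex -> seq vertex;
  lab : vertex -> label;
  succ_arity : forall v, size (succ v) = arity (lab v);
  root_reach : forall v, connect (grel succ) root v }.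

Definition has_box (G : graph) (s : seq G) : bool :=
  has (fun v => lab v == LBox) s.

Definition guarded (G : graph) : Prop :=
  forall c : seq G,
    c != [::] -> cycle (grel (@succ G)) c -> uniq c -> has_box c.

Record cformula : Type := CFormula {
  cgraph :> graph;
  cguarded : guarded cgraph }.

Definition bisimulation (G H : graph) (R : G -> H -> Prop) : Prop :=
  forall (a : G) (b : H), R a b ->
    lab a = lab b /\
    forall i, i < arity (lab a) -> R (nth a (succ a) i) (nth b (succ b) i).

Definition bisimilar (G H : graph) : Prop :=
  exists R : G -> H -> Prop, bisimulation R /\ R (root G) (root H).

Lemma guarded_embed (G H : graph) (f : G -> H) :
  injective f ->
  (forall v, lab (f v) = lab v) ->
  (forall v, succ (f v) = map f (succ v)) ->
  guarded G ->
  forall (c : seq H) (v : G),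
    f v \in c -> cycle (grel (@succ H)) c -> uniq c -> has_box c.
Proof.
move=> injf labf succf gG c v /rot_to[i s Ec] cyc un.
have {}cyc : cycle (grel (@succ H)) (f v :: s) by rewrite -Ec rot_cycle.
have {}un : uniq (f v :: s) by rewrite -Ec rot_uniq.
have pathP t x : path (grel (@succ H)) (f x) t ->
    exists2 t', t = map f t' & path (grel (@succ G)) x t'.
  elim: t x => [|y t IH] x /=; first by exists [::].
  case/andP; rewrite succf => /mapP[z zx ->] /IH[t' -> pt'].
  by exists (z :: t') => //=; rewrite zx.
move: cyc => /= /pathP[t]; case/lastP: t => [|t z].
  by move=> /(congr1 size); rewrite size_rcons.
rewrite map_rcons => /rcons_inj[Es /injf <-] ptz.
have : has_box (v :: t).
  apply: gG => //; move: un.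
  by rewrite Es -map_cons map_inj_uniq.
rewrite /has_box => bt.
rewrite -(has_rot i) Ec Es -map_cons has_map.
by apply: sub_has bt => x /=; rewrite labf.
Qed.

(* A connective adds a fresh root above disjoint copies of its arguments.
   Graphs are not quotiented by isomorphism or sharing: [CHL_bisim] together
   with modus ponens makes [CHL] invariant under the representation. *)
Section Connectives.
Variable l : label.

Section Nullary.
Hypothesis l0 : arity l = 0.

Lemma node0_arity (v : unit) : size ([::] : seq unit) = arity l.
Proof. by rewrite l0. Qed.

Lemma node0_reach (v : unit) : connect (grel (fun _ : unit => [::])) tt v.
Proof. by case: v; apply: connect0. Qed.

Definition node0_graph : graph :=
  @Graph unit tt (fun _ => [::]) (fun _ => l) node0_arity node0_reach.

Lemma node0_guarded : guarded node0_graph.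
Proof. by case=> // x [|y s]. Qed.

Definition node0 : cformula := CFormula node0_guarded.
End Nullary.

Section Unary.
Hypothesis l1 : arity l = 1.
Variable phi : cformula.

Definition node1_succ (v : option phi) : seq (option phi) :=
  if v is Some x then map Some (succ x) else [:: Some (root phi)].

Definition node1_lab (v : option phi) : label :=
  if v is Some x then lab x else l.

Lemma node1_arity v : size (node1_succ v) = arity (node1_lab v).
Proof. by case: v => [x|] /=; rewrite ?size_map ?succ_arity ?l1. Qed.

Lemma node1_reach v : connect (grel node1_succ) None v.
Proof.
case: v => [x|]; last exact: connect0.
apply: connect_trans (connect1 (_ : grel node1_succ _ (Some (root phi)))) _.
  by rewrite /= inE.
have /connectP[s ps ->] := root_reach x; apply/connectP.
exists (map Some s); last by rewrite last_map.
rewrite path_map; apply: sub_path ps => a b /= ab.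
by rewrite map_f.
Qed.

Definition node1_graph : graph :=
  @Graph (option phi) None node1_succ node1_lab node1_arity node1_reach.

Lemma node1_guarded : guarded node1_graph.
Proof.
case=> // x s _ cyc un.
have xc : x \in x :: s by rewrite mem_head.
have := next_cycle cyc xc; rewrite /= => e.
have [y Ey] : exists y : phi, next (x :: s) x = Some y.
  case: (x) e => [z|] /=; first by case/mapP => y _; exists y.
  by rewrite inE => /eqP ->; exists (root phi).
have yc : Some y \in x :: s by rewrite -Ey mem_next.
apply: (@guarded_embed phi node1_graph Some _ _ _ (@cguarded phi)) yc cyc un => //.
exact: Some_inj.
Qed.

Definition node1 : cformula := CFormula node1_guarded.
End Unary.

Section Binary.
Hypothesis l2 : arity l = 2.
Variables phi psi : cformula.

Definition node2_succ (v : option (phi + psi)) : seq (option (phi + psi)) :=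
  match v with
  | None => [:: Some (inl (root phi)); Some (inr (root psi))]
  | Some (inl x) => map (Some \o inl) (succ x)
  | Some (inr y) => map (Some \o inr) (succ y)
  end.

Definition node2_lab (v : option (phi + psi)) : label :=
  match v with
  | None => l
  | Some (inl x) => lab x
  | Some (inr y) => lab y
  end.

Lemma node2_arity v : size (node2_succ v) = arity (node2_lab v).
Proof. by case: v => [[x|x]|] /=; rewrite ?size_map ?succ_arity ?l2. Qed.

Lemma node2_reach v : connect (grel node2_succ) None v.
Proof.
case: v => [[x|x]|]; last exact: connect0.
- apply: connect_trans
    (connect1 (_ : grel node2_succ _ (Some (inl (root phi))))) _.
    by rewrite /= !inE eqxx.
  have /connectP[s ps ->] := root_reach x; apply/connectP.
  exists (map (Some \o inl) s); last by rewrite (last_map (Some \o inl)).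
  rewrite path_map; apply: sub_path ps => a b /= ab.
  by rewrite (map_f (Some \o inl)).
- apply: connect_trans
    (connect1 (_ : grel node2_succ _ (Some (inr (root psi))))) _.
    by rewrite /= !inE eqxx orbT.
  have /connectP[s ps ->] := root_reach x; apply/connectP.
  exists (map (Some \o inr) s); last by rewrite (last_map (Some \o inr)).
  rewrite path_map; apply: sub_path ps => a b /= ab.
  by rewrite (map_f (Some \o inr)).
Qed.

Definition node2_graph : graph :=
  @Graph (option (phi + psi)) None node2_succ node2_lab node2_arity
    node2_reach.

Lemma node2_guarded : guarded node2_graph.
Proof.
case=> // x s _ cyc un.
have xc : x \in x :: s by rewrite mem_head.
have := next_cycle cyc xc; rewrite /= => e.
have [y Ey] : exists y : phi + psi, next (x :: s) x = Some y.
  case: (x) e => [[z|z]|] /=.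
  - by case/mapP => y _ ->; exists (inl y).
  - by case/mapP => y _ ->; exists (inr y).
  - rewrite !inE => /orP[] /eqP ->; first by exists (inl (root phi)).
    by exists (inr (root psi)).
have: Some y \in x :: s by rewrite -Ey mem_next.
case: y {Ey} => y yc.
- apply: (@guarded_embed phi node2_graph (Some \o inl) _ _ _ (@cguarded phi))
    yc cyc un => //.
  by move=> a b [].
- apply: (@guarded_embed psi node2_graph (Some \o inr) _ _ _ (@cguarded psi))
    yc cyc un => //.
  by move=> a b [].
Qed.

Definition node2 : cformula := CFormula node2_guarded.
End Binary.

End Connectives.

Definition cbot : cformula := @node0 LBot erefl.
Definition ctop : cformula := @node0 LTop erefl.
Definition cvar (p : nat) : cformula := @node0 (LVar p) erefl.
Definition cneg (phi : cformula) : cformula := @node1 LNeg erefl phi.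
Definition cbox (phi : cformula) : cformula := @node1 LBox erefl phi.
Definition cand (phi psi : cformula) : cformula := @node2 LAnd erefl phi psi.
Definition cor (phi psi : cformula) : cformula := @node2 LOr erefl phi psi.
Definition cimp (phi psi : cformula) : cformula := @node2 LImp erefl phi psi.
Definition ciff (phi psi : cformula) : cformula :=
  cand (cimp phi psi) (cimp psi phi).

(* Paths are vertex sequences [x :: s] including both endpoints, so a box at
   the root counts, and a formula whose root is labelled [p] is not
   modalised in [p]. *)
Definition modalised (p : nat) (phi : cformula) : Prop :=
  forall s : seq phi,
    path (grel (@succ phi)) (root phi) s ->
    lab (last (root phi) s) = LVar p ->
    has_box (root phi :: s).

Section Digamma.
Variables (p : nat) (phi : cformula).
Hypothesis modp : modalised p phi.

Lemma root_not_var : lab (root phi) != LVar p.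
Proof.
apply/eqP => rp; have := @modp [::] isT rp.
by rewrite /has_box /= rp.
Qed.

(* The quotient identifying the root with all p-labelled vertices: the root
   represents its class, every other class is a singleton. *)
Definition dvertex : finType := {v : phi | lab v != LVar p}.

Definition droot : dvertex := Sub (root phi) root_not_var.

Definition dproj (v : phi) : dvertex := insubd droot v.

Definition dsucc (v : dvertex) : seq dvertex := map dproj (succ (val v)).

Definition dlab (v : dvertex) : label := lab (val v).

Lemma dproj_val (v : dvertex) : dproj (val v) = v.
Proof. exact: valKd. Qed.

Lemma dproj_var (v : phi) : lab v = LVar p -> dproj v = droot.
Proof. by move=> vp; rewrite /dproj /insubd insubF // vp eqxx. Qed.

Lemma dproj_nvar (v : phi) : lab v != LVar p -> val (dproj v) = v.
Proof. by move=> vp; rewrite /dproj insubdK. Qed.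

Lemma digamma_arity v : size (dsucc v) = arity (dlab v).
Proof. by rewrite size_map succ_arity. Qed.

Lemma digamma_reach v : connect (grel dsucc) droot v.
Proof.
have /connectP[s] := root_reach (val v).
elim/last_ind: s v => [|s y IH] v.
  move=> _ Ev; rewrite (_ : v = droot); first exact: connect0.
  exact: val_inj.
rewrite rcons_path last_rcons => /andP[ps e] Ev.
have lv : lab (last (root phi) s) != LVar p.
  by apply/eqP => l0; move: e; rewrite /= -[_ \in _]andbT;
     case: (succ _) (succ_arity (last (root phi) s)) => //= a b; rewrite l0.
apply: connect_trans (IH (dproj (last (root phi) s)) ps _) _.
  exact: dproj_nvar.
apply: connect1; rewrite -(dproj_val v) Ev /= /dsucc dproj_nvar //.
exact: map_f.
Qed.

Definition digamma_graph : graph :=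
  @Graph dvertex droot dsucc dlab digamma_arity digamma_reach.

Lemma dsucc_val (x y : dvertex) :
  y != droot -> y \in dsucc x -> val y \in succ (val x).
Proof.
move=> yr /mapP[w wx Ey]; have wp : lab w != LVar p.
  by apply: contraNneq yr => /dproj_var <-; rewrite Ey.
by rewrite Ey dproj_nvar.
Qed.

Lemma dpath_val (x : dvertex) s :
  droot \notin s -> path (grel dsucc) x s ->
  path (grel (@succ phi)) (val x) (map val s).
Proof.
elim: s x => //= y s IH x; rewrite inE negb_or eq_sym => /andP[yr rs].
by case/andP=> /(dsucc_val yr) -> /(IH _ rs).
Qed.

Lemma digamma_guarded : guarded digamma_graph.
Proof.
move=> c c0 cyc un.
have has_val (t : seq dvertex) :
    has_box (map val t : seq phi) -> @has_box digamma_graph t.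
  by rewrite /has_box has_map.
have [/rot_to[i s Ec]|rc] := boolP (droot \in c).
  rewrite /has_box -(has_rot i) Ec; apply: (has_val (droot :: s)).
  have : cycle (grel dsucc) (droot :: s) by rewrite -Ec rot_cycle.
  have : uniq (droot :: s) by rewrite -Ec rot_uniq.
  move=> us; case/andP: (us) => rs _.
  rewrite /= rcons_path => /andP[/(dpath_val rs) ps].
  case/mapP=> w wl Ew.
  have Es : last (root phi) (map val s) = val (last droot s).
    exact: (last_map val s droot).
  have [wp|wp] := eqVneq (lab w) (LVar p).
    have := @modp (rcons (map val s) w).
    rewrite rcons_path last_rcons ps Es => /(_ wl wp).
    by rewrite /has_box /= has_rcons wp.
  have Ewr : w = root phi by rewrite -(dproj_nvar wp) -Ew.
  apply: (@cguarded phi (map val (droot :: s))) => //; last first.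
    by rewrite map_inj_uniq //; apply: val_inj.
  by rewrite /= rcons_path ps Es -Ewr.
apply: has_val; case: c c0 cyc un rc => // x s _ cyc un rc.
apply: (@cguarded phi (map val (x :: s))) => //; last first.
  by rewrite map_inj_uniq //; apply: val_inj.
rewrite /cycle /= -map_rcons; apply: dpath_val => //.
by rewrite mem_rcons.
Qed.

Definition digamma : cformula := CFormula digamma_guarded.
End Digamma.

Inductive pform : Type :=
  | PBot | PTop
  | PVar of nat
  | PNeg of pform
  | PAnd of pform & pform
  | POr of pform & pform
  | PImp of pform & pform.

Fixpoint peval (v : nat -> bool) (A : pform) : bool :=
  match A with
  | PBot => false
  | PTop => true
  | PVar q => v q
  | PNeg B => ~~ peval v B
  | PAnd B C => peval v B && peval v C
  | POr B C => peval v B || peval v C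
  | PImp B C => peval v B ==> peval v C
  end.

Definition tautology (A : pform) : Prop := forall v, peval v A.

Fixpoint instance (sigma : nat -> cformula) (A : pform) : cformula :=
  match A with
  | PBot => cbot
  | PTop => ctop
  | PVar q => sigma q
  | PNeg B => cneg (instance sigma B)
  | PAnd B C => cand (instance sigma B) (instance sigma C)
  | POr B C => cor (instance sigma B) (instance sigma C)
  | PImp B C => cimp (instance sigma B) (instance sigma C)
  end.

Inductive CHL : cformula -> Prop :=
  | CHL_taut (A : pform) (sigma : nat -> cformula) :
      tautology A -> CHL (instance sigma A)
  | CHL_K (phi psi : cformula) :
      CHL (cimp (cbox (cimp phi psi)) (cimp (cbox phi) (cbox psi)))
  | CHL_bisim (phi psi : cformula) :
      bisimilar phi psi -> CHL (ciff phi psi)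
  | CHL_mp (phi psi : cformula) :
      CHL (cimp phi psi) -> CHL phi -> CHL psi
  | CHL_nec (phi : cformula) :
      CHL phi -> CHL (cbox phi)
  | CHL_loeb (phi : cformula) :
      CHL (cimp (cbox phi) phi) -> CHL phi.

(* Main.v *)
(** By Loeb's rule, a finite guarded system of equations has, up to provable
    equivalence, at most one solution: if [C] is the conjunction of the
    equivalences between two solutions, then [Box C -> C], by induction along
    the box-free edges, which are well-founded by guardedness.  Let [chi] be
    [digamma p. phi].  Since [CHL] is closed under substitution,
    [psi[p := chi]] is equivalent to [phi[p := chi]], which is bisimilar to
    [chi].  Hence the subformulas of [psi], with [chi] substituted for [p],
    solve the system given by the graph [digamma p. psi], and so do the
    subformulas of [digamma p. psi]. *)
From HB Require Import structures.
From mathcomp Require Import all_boot.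
Require Import Defs.

Set Implicit Arguments.
Unset Strict Implicit.
Unset Printing Implicit Defensive.

(** * Guarded systems *)

Section Rank.
Variable phi : cformula.

Definition flat_step : rel phi :=
  fun x y => (lab x != LBox) && (y \in succ x).

Definition formula_rank (x : phi) : nat := #|[pred y | connect flat_step x y]|.

(** Everything box-free reachable from [y] is so from [x], but [x] is not reachable from [y]: a way
    back would close a box-free cycle. *)
Lemma formula_rank_lt (x y : phi) :
  lab x != LBox -> y \in succ x -> formula_rank y < formula_rank x.
Proof.
move=> lx xy; have exy : flat_step x y by rewrite /flat_step lx.
apply/proper_card/properP; split.
  by apply/subsetP=> z; rewrite !inE; apply/connect_trans/connect1.
exists x; rewrite !inE ?connect0 //; apply/negP => /connectP[s0 ps0].
case/shortenP: ps0 => s ps us _ Ex.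
have cyc : cycle flat_step (y :: s) by rewrite /= rcons_path ps -Ex.
have : has_box (y :: s).
  apply: (@cguarded phi) => //.
  by apply: sub_path cyc => a b /andP[].
(* The box [z] on the cycle has an outgoing [flat_step], which its label forbids. *)
case/hasP=> z zs lz; have := next_cycle cyc zs.
by rewrite /flat_step lz.
Qed.
End Rank.

(* Unlike a [cformula], a system has no root, hence no reachability condition;
   guardedness is given by a rank decreasing along the box-free edges. *)
Record system : Type := System {
  carrier :> finType;
  ssucc : carrier -> seq carrier;
  slab : carrier -> label;
  ssucc_arity : forall v, size (ssucc v) = arity (slab v);
  srank : carrier -> nat;
  srank_lt : forall x y,
    slab x != LBox -> y \in ssucc x -> srank y < srank x }.

Definition system_of (phi : cformula) : system :=
  System (@succ_arity phi) (@formula_rank_lt phi).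

(** * The formula generated by a vertex of a system *)

Section Generated.
Variables (S : system) (v : S).

Definition gvertex : finType := {w : S | connect (grel (@ssucc S)) v w}.

Definition groot : gvertex := Sub v (connect0 _ _).

(** The default [groot] is never taken, as successors of reachable vertices are reachable. *)
Definition gsucc (w : gvertex) : seq gvertex :=
  map (insubd groot) (ssucc (val w)).

Definition glab (w : gvertex) : label := slab (val w).

Lemma val_gsucc (w : gvertex) : map val (gsucc w) = ssucc (val w).
Proof.
rewrite -map_comp map_id_in // => x xw /=; rewrite insubdK //.
exact: connect_trans (valP w) (connect1 _).
Qed.

Lemma gsucc_arity w : size (gsucc w) = arity (glab w).
Proof. by rewrite size_map ssucc_arity. Qed.

Lemma gsucc_reach w : connect (grel gsucc) groot w.
Proof.
have /connectP[s] := valP w.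
elim/last_ind: s w => [|s y IH] w.
  by move=> _ Ew; rewrite (_ : w = groot) ?connect0 //; apply: val_inj.
rewrite rcons_path last_rcons => /andP[ps e] Ew.
have cl : connect (grel (@ssucc S)) v (last v s) by apply/connectP; exists s.
apply: connect_trans (IH (Sub (last v s) cl) ps _) _; first by [].
apply: connect1; rewrite /= -(mem_map val_inj) val_gsucc.
by move: e; rewrite /= -Ew.
Qed.

Definition gen_graph : graph := Graph gsucc_arity gsucc_reach.

(** Along a box-free cycle the rank would drop at every edge, hence be smaller than itself. *)
Lemma gen_guarded : guarded gen_graph.
Proof.
case=> // x s _ cyc _; apply/negPn/negP => /hasPn nb.
have tr : transitive (fun a b : gvertex => srank (val b) < srank (val a)).
  by move=> b a c ab bc; apply: ltn_trans bc ab.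
have : path (fun a b : gvertex => srank (val b) < srank (val a)) x (rcons s x).
  apply: (@sub_in_path _ (fun a => a \in x :: s)) cyc.
  - move=> a b /= as_ _ ab; apply: srank_lt; first exact: nb as_.
    by rewrite -val_gsucc map_f.
  - by apply/allP=> a; rewrite !inE mem_rcons inE orbA orbb.
move/(order_path_min tr)/allP/(_ x).
by rewrite mem_rcons mem_head ltnn => /(_ isT).
Qed.

Definition gen : cformula := CFormula gen_guarded.
End Generated.

(** * Bisimilarity between vertices of systems *)

Definition sbisimulation (S T : system) (R : S -> T -> Prop) : Prop :=
  forall a b, R a b ->
    slab a = slab b /\
    forall i, i < arity (slab a) -> R (nth a (ssucc a) i) (nth b (ssucc b) i).

Definition sbisimilar (S T : system) (a : S) (b : T) : Prop :=
  exists R : S -> T -> Prop, sbisimulation R /\ R a b.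

Lemma sbisimilar_sym (S T : system) (a : S) (b : T) :
  sbisimilar a b -> sbisimilar b a.
Proof.
case=> R [bR Rab]; exists (fun y x => R x y); split=> // y x /bR[l n].
by split=> // i; rewrite -l; apply: n.
Qed.

Lemma sbisimilar_trans (S T U : system) (b : T) (a : S) (c : U) :
  sbisimilar a b -> sbisimilar b c -> sbisimilar a c.
Proof.
case=> R [bR Rab] [Q [bQ Qbc]].
exists (fun x z => exists2 y, R x y & Q y z); split; last by exists b.
move=> x z [y /bR[lxy nxy] /bQ[lyz nyz]]; split; first by rewrite lxy.
move=> i li; exists (nth y (ssucc y) i); first exact: nxy.
by apply: nyz; rewrite -lxy.
Qed.

(** The graph of [f] is a bisimulation. *)
Lemma sbisimilar_hom (S T : system) (f : S -> T) (a : S) :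
  (forall x, slab (f x) = slab x) ->
  (forall x, ssucc (f x) = map f (ssucc x)) ->
  sbisimilar a (f a).
Proof.
move=> fl fs; exists (fun x y => y = f x); split=> // x _ ->.
split=> // i li; rewrite fs (nth_map x) //.
by rewrite ssucc_arity.
Qed.

Lemma sbisimilar_gen (S : system) (v : S) :
  sbisimilar (root (gen v) : system_of (gen v)) v.
Proof.
apply: (@sbisimilar_hom (system_of (gen v)) S (fun x : gvertex v => val x));
  move=> // x.
exact/esym/val_gsucc.
Qed.

Lemma bisimilar_of_sbisimilar (phi psi : cformula) :
  sbisimilar (root phi : system_of phi) (root psi : system_of psi) ->
  bisimilar phi psi.
Proof. by []. Qed.

Lemma bisimilar_gen (S T : system) (a : S) (b : T) :
  sbisimilar a b -> bisimilar (gen a) (gen b).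
Proof.
move=> ab; apply: bisimilar_of_sbisimilar.
apply: sbisimilar_trans (sbisimilar_gen a) _.
exact: sbisimilar_trans ab (sbisimilar_sym (sbisimilar_gen b)).
Qed.

Lemma bisimilar_gen_root (phi : cformula) (S : system) (v : S) :
  sbisimilar v (root phi : system_of phi) -> bisimilar (gen v) phi.
Proof.
move/(sbisimilar_trans (sbisimilar_gen v)); exact: bisimilar_of_sbisimilar.
Qed.

(** * One-step unfolding of a vertex into a connective *)

Lemma sbisimilar_node0 (l : label) (l0 : arity l = 0) (S : system) (v : S) :
  slab v = l ->
  sbisimilar (root (node0 l0) : system_of (node0 l0)) v.
Proof.
move=> lv; exists (fun _ y => y = v); split=> // -[] _ ->.
by split=> // i; rewrite /= l0.
Qed.

Lemma sbisimilar_node1 (l : label) (l1 : arity l = 1) (phi : cformula)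
    (S : system) (v a : S) :
  slab v = l -> ssucc v = [:: a] ->
  sbisimilar (root phi : system_of phi) a ->
  sbisimilar (root (node1 l1 phi) : system_of (node1 l1 phi)) v.
Proof.
move=> lv sv [R [bR Ra]].
exists (fun x y => if x is Some z then R z y else y = v); split=> //.
move=> [x|] y /=; last first.
  by move=> ->; rewrite lv sv l1; split=> // -[].
move=> /bR[lxy nxy]; split=> // i li.
by rewrite (nth_map x) ?succ_arity //; apply: nxy.
Qed.

(** The bisimulations of the two arguments are joined, and the fresh root is paired with [v]. *)
Lemma sbisimilar_node2 (l : label) (l2 : arity l = 2) (phi psi : cformula)
    (S : system) (v a b : S) :
  slab v = l -> ssucc v = [:: a; b] ->
  sbisimilar (root phi : system_of phi) a ->
  sbisimilar (root psi : system_of psi) b ->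
  sbisimilar (root (node2 l2 phi psi) : system_of (node2 l2 phi psi)) v.
Proof.
move=> lv sv [R [bR Ra]] [Q [bQ Qb]].
exists (fun x y => match x with
  | Some (inl z) => R z y | Some (inr z) => Q z y | None => y = v end).
split=> // -[[x|x]|] y /=; last first.
- by move=> ->; rewrite lv sv l2; split=> // -[|[]].
- move=> /bQ[lxy nxy]; split=> // i li.
  by rewrite (nth_map x) ?succ_arity //; apply: nxy.
- move=> /bR[lxy nxy]; split=> // i li.
  by rewrite (nth_map x) ?succ_arity //; apply: nxy.
Qed.

(** Arguments come as a function on all indices, of which only those below [arity l] matter; this
    treats all labels uniformly. *)
Definition cnode (l : label) (f : nat -> cformula) : cformula :=
  match l with
  | LBot => cbot
  | LTop => ctop
  | LVar q => cvar q
  | LNeg => cneg (f 0)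
  | LBox => cbox (f 0)
  | LAnd => cand (f 0) (f 1)
  | LOr => cor (f 0) (f 1)
  | LImp => cimp (f 0) (f 1)
  end.

Lemma sbisimilar_cnode (S : system) (v : S) (l : label)
    (f : nat -> cformula) :
  slab v = l ->
  (forall i, i < arity l ->
     sbisimilar (root (f i) : system_of (f i)) (nth v (ssucc v) i)) ->
  sbisimilar (root (cnode l f) : system_of (cnode l f)) v.
Proof.
move=> lv; move: (ssucc_arity v); rewrite lv.
case: l lv => [||q|||||] lv /= sz fv;
  move: sz fv; case sv: (ssucc v) => [|a [|b []]] //= _ fv;
  by [apply: sbisimilar_node0
     |apply: (sbisimilar_node1 _ lv sv (fv 0 isT))
     |apply: (sbisimilar_node2 _ lv sv (fv 0 isT) (fv 1 isT))].
Qed.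

Lemma bisimilar_gen_cnode (S : system) (v : S) :
  bisimilar (gen v) (cnode (slab v) (fun i => gen (nth v (ssucc v) i))).
Proof.
apply/bisimilar_gen_root/sbisimilar_sym/sbisimilar_cnode => // i _.
exact: sbisimilar_gen.
Qed.

(** * Derivations in CHL *)

Notation eqv phi psi := (CHL (ciff phi psi)).

(** Repeated modus ponens turns a tautological implication into a derived rule. The fold in the
    conclusion computes to that rule, so it can be applied directly. *)
Lemma CHL_consequence (sigma : nat -> cformula) (As : seq pform) (A : pform) :
  tautology (foldr PImp A As) ->
  foldr (fun B P => CHL (instance sigma B) -> P) (CHL (instance sigma A)) As.
Proof.
move/(CHL_taut sigma); elim: As => //= B As IH BA HB.
exact/IH/(CHL_mp BA).
Qed.

Ltac by_taut :=
  let v := fresh in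
  move=> v /=; by repeat match goal with |- context [v ?i] => case: (v i) end.

Notation env s := (nth cbot s).

Lemma CHL_iff_mp (a b : cformula) : eqv a b -> CHL a -> CHL b.
Proof.
apply: (@CHL_consequence (env [:: a; b])
  [:: PAnd (PImp (PVar 0) (PVar 1)) (PImp (PVar 1) (PVar 0)); PVar 0]
  (PVar 1)).
by_taut.
Qed.

Lemma eqv_refl (a : cformula) : eqv a a.
Proof.
apply: (@CHL_consequence (env [:: a]) [::]
  (PAnd (PImp (PVar 0) (PVar 0)) (PImp (PVar 0) (PVar 0)))).
by_taut.
Qed.

Lemma eqv_sym (a b : cformula) : eqv a b -> eqv b a.
Proof.
apply: (@CHL_consequence (env [:: a; b])
  [:: PAnd (PImp (PVar 0) (PVar 1)) (PImp (PVar 1) (PVar 0))]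
  (PAnd (PImp (PVar 1) (PVar 0)) (PImp (PVar 0) (PVar 1)))).
by_taut.
Qed.

Lemma eqv_trans (b a c : cformula) : eqv a b -> eqv b c -> eqv a c.
Proof.
apply: (@CHL_consequence (env [:: a; b; c])
  [:: PAnd (PImp (PVar 0) (PVar 1)) (PImp (PVar 1) (PVar 0));
      PAnd (PImp (PVar 1) (PVar 2)) (PImp (PVar 2) (PVar 1))]
  (PAnd (PImp (PVar 0) (PVar 2)) (PImp (PVar 2) (PVar 0)))).
by_taut.
Qed.

Lemma CHL_weaken (h a : cformula) : CHL a -> CHL (cimp h a).
Proof.
apply: (@CHL_consequence (env [:: h; a]) [:: PVar 1] (PImp (PVar 0) (PVar 1))).
by_taut.
Qed.

Lemma CHL_imp_trans (b a c : cformula) :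
  CHL (cimp a b) -> CHL (cimp b c) -> CHL (cimp a c).
Proof.
apply: (@CHL_consequence (env [:: a; b; c])
  [:: PImp (PVar 0) (PVar 1); PImp (PVar 1) (PVar 2)]
  (PImp (PVar 0) (PVar 2))).
by_taut.
Qed.

Lemma CHL_imp_and (h a b : cformula) :
  CHL (cimp h a) -> CHL (cimp h b) -> CHL (cimp h (cand a b)).
Proof.
apply: (@CHL_consequence (env [:: h; a; b])
  [:: PImp (PVar 0) (PVar 1); PImp (PVar 0) (PVar 2)]
  (PImp (PVar 0) (PAnd (PVar 1) (PVar 2)))).
by_taut.
Qed.

Lemma CHL_imp_eqv (h a a' b b' : cformula) :
  eqv a a' -> eqv b b' ->
  CHL (cimp h (ciff a' b')) -> CHL (cimp h (ciff a b)).
Proof.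
apply: (@CHL_consequence (env [:: h; a; a'; b; b'])
  [:: PAnd (PImp (PVar 1) (PVar 2)) (PImp (PVar 2) (PVar 1));
      PAnd (PImp (PVar 3) (PVar 4)) (PImp (PVar 4) (PVar 3));
      PImp (PVar 0)
        (PAnd (PImp (PVar 2) (PVar 4)) (PImp (PVar 4) (PVar 2)))]
  (PImp (PVar 0)
    (PAnd (PImp (PVar 1) (PVar 3)) (PImp (PVar 3) (PVar 1))))).
by_taut.
Qed.

Lemma CHL_box_mono (a b : cformula) :
  CHL (cimp a b) -> CHL (cimp (cbox a) (cbox b)).
Proof. by move/CHL_nec/(CHL_mp (CHL_K a b)). Qed.

Lemma CHL_imp_box_eqv (h a b : cformula) :
  CHL (cimp h (cbox (ciff a b))) -> CHL (cimp h (ciff (cbox a) (cbox b))).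
Proof.
have ab : CHL (cimp (ciff a b) (cimp a b)).
  apply: (@CHL_consequence (env [:: a; b]) [::]
    (PImp (PAnd (PImp (PVar 0) (PVar 1)) (PImp (PVar 1) (PVar 0)))
       (PImp (PVar 0) (PVar 1)))).
  by_taut.
have ba : CHL (cimp (ciff a b) (cimp b a)).
  apply: (@CHL_consequence (env [:: a; b]) [::]
    (PImp (PAnd (PImp (PVar 0) (PVar 1)) (PImp (PVar 1) (PVar 0)))
       (PImp (PVar 1) (PVar 0)))).
  by_taut.
move=> hab; apply: CHL_imp_and.
- exact: CHL_imp_trans (CHL_imp_trans hab (CHL_box_mono ab)) (CHL_K a b).
- exact: CHL_imp_trans (CHL_imp_trans hab (CHL_box_mono ba)) (CHL_K b a).
Qed.

Lemma CHL_imp_cnode (h : cformula) (l : label) (f g : nat -> cformula) :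
  l != LBox ->
  (forall i, i < arity l -> CHL (cimp h (ciff (f i) (g i)))) ->
  CHL (cimp h (ciff (cnode l f) (cnode l g))).
Proof.
pose Eq A B := PAnd (PImp A B) (PImp B A).
pose x i := PVar i.
case: l => [||q|||||] // _ fg; try exact/CHL_weaken/eqv_refl.
- move: (fg 0 isT).
  apply: (@CHL_consequence (env [:: h; f 0; g 0])
    [:: PImp (x 0) (Eq (x 1) (x 2))]
    (PImp (x 0) (Eq (PNeg (x 1)) (PNeg (x 2))))).
  by_taut.
- move: (fg 0 isT) (fg 1 isT).
  apply: (@CHL_consequence (env [:: h; f 0; g 0; f 1; g 1])
    [:: PImp (x 0) (Eq (x 1) (x 2)); PImp (x 0) (Eq (x 3) (x 4))]
    (PImp (x 0) (Eq (PAnd (x 1) (x 3)) (PAnd (x 2) (x 4))))).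
  by_taut.
- move: (fg 0 isT) (fg 1 isT).
  apply: (@CHL_consequence (env [:: h; f 0; g 0; f 1; g 1])
    [:: PImp (x 0) (Eq (x 1) (x 2)); PImp (x 0) (Eq (x 3) (x 4))]
    (PImp (x 0) (Eq (POr (x 1) (x 3)) (POr (x 2) (x 4))))).
  by_taut.
- move: (fg 0 isT) (fg 1 isT).
  apply: (@CHL_consequence (env [:: h; f 0; g 0; f 1; g 1])
    [:: PImp (x 0) (Eq (x 1) (x 2)); PImp (x 0) (Eq (x 3) (x 4))]
    (PImp (x 0) (Eq (PImp (x 1) (x 3)) (PImp (x 2) (x 4))))).
  by_taut.
Qed.

(** The congruences under a hypothesis are used with the trivial hypothesis [ctop]; here boxes cause
    no trouble, since a provable equivalence can be necessitated. *)
Lemma eqv_cnode (l : label) (f g : nat -> cformula) :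
  (forall i, i < arity l -> eqv (f i) (g i)) -> eqv (cnode l f) (cnode l g).
Proof.
have top : CHL ctop by apply: (@CHL_taut PTop (fun=> cbot)).
have [->|lb] := eqVneq l LBox => fg; apply: CHL_mp top.
  exact/CHL_imp_box_eqv/CHL_weaken/CHL_nec/fg.
by apply: CHL_imp_cnode => // i /fg; apply: CHL_weaken.
Qed.

Lemma eqv_node2 (l : label) (a a' b b' : cformula) :
  eqv a a' -> eqv b b' ->
  eqv (cnode l (env [:: a; b])) (cnode l (env [:: a'; b'])).
Proof.
move=> aa bb; apply: eqv_cnode => -[|[|i]] // _.
(* As [l] is arbitrary, indices past the lists must be covered; there both sides are the default
   [cbot]. *)
by case: i => [|i]; apply: eqv_refl.
Qed.

Lemma eqv_imp (a a' b b' : cformula) :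
  eqv a a' -> eqv b b' -> eqv (cimp a b) (cimp a' b').
Proof. exact: (@eqv_node2 LImp). Qed.

Lemma eqv_box (a b : cformula) : eqv a b -> eqv (cbox a) (cbox b).
Proof.
by move=> ab; apply: (@eqv_cnode LBox (env [:: a]) (env [:: b])) => -[].
Qed.

Definition bigand (s : seq cformula) : cformula := foldr cand ctop s.

Lemma CHL_bigand_elim (T : eqType) (f : T -> cformula) (s : seq T) (x : T) :
  x \in s -> CHL (cimp (bigand (map f s)) (f x)).
Proof.
elim: s => //= y s IH; rewrite inE => /orP[/eqP <-|/IH].
- apply: (@CHL_consequence (env [:: f x; bigand (map f s)]) [::]
    (PImp (PAnd (PVar 0) (PVar 1)) (PVar 0))).
  by_taut.
- apply: (@CHL_consequence (env [:: f x; bigand (map f s); f y])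
    [:: PImp (PVar 1) (PVar 0)]
    (PImp (PAnd (PVar 2) (PVar 1)) (PVar 0))).
  by_taut.
Qed.

Lemma CHL_bigand_intro (T : Type) (h : cformula) (f : T -> cformula)
    (s : seq T) :
  (forall x, CHL (cimp h (f x))) -> CHL (cimp h (bigand (map f s))).
Proof.
move=> hf; elim: s => [|x s IH] /=; last exact: CHL_imp_and.
exact/CHL_weaken/(@CHL_taut PTop (fun=> cbot)).
Qed.

(** * Uniqueness of solutions *)

(** Each vertex is an unknown, with the equation read off its label and successors. *)
Definition solution (S : system) (F : S -> cformula) : Prop :=
  forall w, eqv (F w) (cnode (slab w) (fun i => F (nth w (ssucc w) i))).

Lemma solution_unique (S : system) (F G : S -> cformula) :
  solution F -> solution G -> forall w, eqv (F w) (G w).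
Proof.
move=> solF solG w.
pose D x := ciff (F x) (G x); pose C := bigand (map D (enum S)).
have CD x : CHL (cimp C (D x)).
  by apply: CHL_bigand_elim; rewrite mem_enum.
suff CC : CHL (cimp (cbox C) C) by exact: CHL_mp (CD w) (CHL_loeb CC).
(* Strong induction on the rank of [x], with [n] as a strict upper bound. *)
apply: CHL_bigand_intro => x; move: {2}_.+1 (ltnSn (srank x)) => n.
elim: n x => // n IH x; rewrite ltnS => xn.
apply: CHL_imp_eqv (solF x) (solG x) _.
have [->|lb] := eqVneq (slab x) LBox.
  (* At a box no induction hypothesis is needed: [cbox C] yields the boxed equivalence at the
     successor. *)
  exact/CHL_imp_box_eqv/CHL_box_mono/CD.
apply: CHL_imp_cnode => // i li; apply: IH; apply: leq_trans xn.
by apply: srank_lt => //; rewrite mem_nth // ssucc_arity.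
Qed.

Lemma gen_solution (S : system) : solution (@gen S).
Proof. move=> w; exact/CHL_bisim/bisimilar_gen_cnode. Qed.

(** * Substitution *)

Section Substitution.
Variables (p : nat) (chi : cformula).

Section System.
Variable phi : cformula.

(* Instead of redirecting edges, every [p]-vertex is turned into a copy of the
   root of [chi]. *)
Definition sub_succ (v : phi + chi) : seq (phi + chi) :=
  match v with
  | inl x => if lab x == LVar p then map inr (succ (root chi))
             else map inl (succ x)
  | inr y => map inr (succ y)
  end.

Definition sub_lab (v : phi + chi) : label :=
  match v with
  | inl x => if lab x == LVar p then lab (root chi) else lab x
  | inr y => lab y
  end.

(** The summand [formula_rank (root chi)] makes the rank drop along edges from a [p]-vertex into
    [chi]; between vertices of [phi] it cancels. *)
Definition sub_rank (v : phi + chi) : nat :=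
  match v with
  | inl x => formula_rank x + formula_rank (root chi)
  | inr y => formula_rank y
  end.

Lemma sub_arity v : size (sub_succ v) = arity (sub_lab v).
Proof. by case: v => x /=; try case: ifP => _; rewrite size_map succ_arity. Qed.

Lemma sub_rank_lt x y :
  sub_lab x != LBox -> y \in sub_succ x -> sub_rank y < sub_rank x.
Proof.
case: x => x /=; [case: ifP => _|] => lx /mapP[z zx ->] /=.
- by rewrite ltn_addl // formula_rank_lt.
- by rewrite ltn_add2r formula_rank_lt.
- exact: formula_rank_lt.
Qed.

Definition sub_system : system := System sub_arity sub_rank_lt.

Definition sub : cformula := gen (inl (root phi) : sub_system).
End System.

Lemma sbisimilar_sub (phi psi : cformula) (v : phi) (w : psi) :
  sbisimilar (v : system_of phi) (w : system_of psi) ->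
  sbisimilar (inl v : sub_system phi) (inl w : sub_system psi).
Proof.
case=> R [bR Rvw].
(* The given bisimulation on the substituted formulas, and equality on the copies of [chi]. *)
exists (fun x y => match x, y with
  | inl a, inl b => R a b | inr a, inr b => a = b | _, _ => False end).
split=> // -[a|a] [b|b] //=; last first.
  move=> <-; split=> // i li.
  by rewrite !(nth_map a) ?succ_arity.
move=> /bR[/= lab_ nab]; rewrite -lab_; case: ifP => _; split=> // i li.
  by rewrite !(nth_map (root chi)) ?succ_arity.
rewrite (nth_map a) ?succ_arity // (nth_map b) ?succ_arity -?lab_ //.
exact: nab.
Qed.

Lemma bisimilar_sub (phi psi : cformula) :
  bisimilar phi psi -> bisimilar (sub phi) (sub psi).
Proof. move=> b; exact/bisimilar_gen/sbisimilar_sub. Qed.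

(** Meant for the embeddings of the arguments into a compound formula. *)
Lemma sub_hom (phi psi : cformula) (f : phi -> psi) :
  (forall x, lab (f x) = lab x) ->
  (forall x, succ (f x) = map f (succ x)) ->
  sbisimilar (root (sub phi) : system_of (sub phi))
    (inl (f (root phi)) : sub_system psi).
Proof.
move=> fl fs; apply: sbisimilar_trans (sbisimilar_gen _) _.
apply: sbisimilar_sub; exact: (@sbisimilar_hom (system_of phi) (system_of psi)).
Qed.

(** The root keeps its label since it is not a [p]-vertex, and each argument embeds into the
    compound formula. *)
Lemma sub_cnode (l : label) (f : nat -> cformula) :
  l != LVar p -> eqv (sub (cnode l f)) (cnode l (fun i => sub (f i))).
Proof.
move=> lp; apply: CHL_bisim; apply: bisimilar_gen_root; apply: sbisimilar_sym.
have lr : lab (root (cnode l f)) = l by case: l {lp}.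
set v : sub_system _ := inl _.
have lv : slab v = l by rewrite /= lr (negPf lp).
apply: (sbisimilar_cnode lv); rewrite {lv}/v /= lr (negPf lp) {lr}.
case: l lp => [||q|||||] // lp [|[|i]] //= _;
  by [exact: (@sub_hom (f 0) (node1 _ (f 0)) Some)
     |exact: (@sub_hom (f 0) (node2 _ (f 0) (f 1)) (Some \o inl))
     |exact: (@sub_hom (f 1) (node2 _ (f 0) (f 1)) (Some \o inr))].
Qed.
End Substitution.

(** The variables of [A] are placeholders unrelated to [p], so substitution only acts on the values
    of [sigma]. *)
Lemma sub_instance (p : nat) (chi : cformula) (sigma : nat -> cformula)
    (A : pform) :
  eqv (sub p chi (instance sigma A))
    (instance (fun q => sub p chi (sigma q)) A).
Proof.
elim: A => [||q|A IHA|A IHA B IHB|A IHA B IHB|A IHA B IHB] /=.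
- exact: (@sub_cnode p chi LBot (env [::])).
- exact: (@sub_cnode p chi LTop (env [::])).
- exact: eqv_refl.
- apply: eqv_trans (@sub_cnode p chi LNeg (env [:: _]) isT) _.
  by apply: (@eqv_cnode LNeg _ (env [:: _])) => -[].
- apply: eqv_trans (@sub_cnode p chi LAnd (env [:: _; _]) isT) _.
  exact: (@eqv_node2 LAnd).
- apply: eqv_trans (@sub_cnode p chi LOr (env [:: _; _]) isT) _.
  exact: (@eqv_node2 LOr).
- apply: eqv_trans (@sub_cnode p chi LImp (env [:: _; _]) isT) _.
  exact: (@eqv_node2 LImp).
Qed.

Lemma sub_imp (p : nat) (chi a b : cformula) :
  eqv (sub p chi (cimp a b)) (cimp (sub p chi a) (sub p chi b)).
Proof. exact: (@sub_cnode p chi LImp (env [:: a; b])). Qed.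

Lemma sub_box (p : nat) (chi a : cformula) :
  eqv (sub p chi (cbox a)) (cbox (sub p chi a)).
Proof. exact: (@sub_cnode p chi LBox (env [:: a])). Qed.

Lemma sub_iff (p : nat) (chi a b : cformula) :
  eqv (sub p chi (ciff a b)) (ciff (sub p chi a) (sub p chi b)).
Proof.
apply: eqv_trans (@sub_cnode p chi LAnd (env [:: _; _]) isT) _.
exact: (@eqv_node2 LAnd _ _ _ _ (sub_imp p chi a b) (sub_imp p chi b a)).
Qed.

(** By induction on the derivation; substitution commutes with connectives only up to provable
    equivalence, so the cases transport along such equivalences. *)
Lemma CHL_sub (p : nat) (chi phi : cformula) : CHL phi -> CHL (sub p chi phi).
Proof.
elim=> {phi} [A sigma tA|a b|a b ab|a b _ IHab _ IHa|a _ IH|a _ IH].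
- exact: CHL_iff_mp (eqv_sym (sub_instance p chi sigma A)) (CHL_taut _ tA).
- apply: CHL_iff_mp (CHL_K (sub p chi a) (sub p chi b)); apply: eqv_sym.
  apply: eqv_trans (sub_imp _ _ _ _) _; apply: eqv_imp.
    exact: eqv_trans (sub_box _ _ _) (eqv_box (sub_imp _ _ _ _)).
  apply: eqv_trans (sub_imp _ _ _ _) _.
  by apply: eqv_imp; apply: sub_box.
- apply: CHL_iff_mp (eqv_sym (sub_iff _ _ _ _)) _.
  exact/CHL_bisim/bisimilar_sub.
- exact: CHL_mp (CHL_iff_mp (sub_imp _ _ _ _) IHab) IHa.
- exact: CHL_iff_mp (eqv_sym (sub_box _ _ _)) (CHL_nec IH).
- apply: CHL_loeb; apply: CHL_iff_mp IH.
  apply: eqv_trans (sub_imp _ _ _ _) _.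
  by apply: eqv_imp; [apply: sub_box | apply: eqv_refl].
Qed.

(** * Substituting the fixed point for [p] *)

Section FixedPoint.
Variables (p : nat) (phi : cformula).
Hypothesis modp : modalised p phi.
Let chi := digamma modp.

Lemma sub_digamma_vertex (v : phi) :
  sbisimilar (inl v : sub_system p chi phi) (dproj modp v : system_of chi).
Proof.
(* This map is a homomorphism: a [p]-vertex carries the label and successors of the root of [chi],
   which is also its class in the quotient. *)
pose f (x : phi + chi) : chi :=
  match x with inl a => dproj modp a | inr b => b end.
apply: (@sbisimilar_hom (sub_system p chi phi) (system_of chi) f (inl v)).
- case=> x //=; case: eqP => [/dproj_var -> //|/eqP xp].
  by rewrite /dlab dproj_nvar.
- case=> x /=; last by rewrite -map_comp map_id.
  case: eqP => [/dproj_var ->|/eqP xp]; rewrite -map_comp ?map_id //.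
  by rewrite /dsucc dproj_nvar.
Qed.

Lemma bisimilar_sub_digamma : bisimilar (sub p chi phi) chi.
Proof.
apply: bisimilar_gen_root.
suff -> : root chi = dproj modp (root phi) by apply: sub_digamma_vertex.
exact: (esym (dproj_val modp (droot modp))).
Qed.

Lemma bisimilar_gen_digamma_root :
  bisimilar (gen (root chi : system_of chi)) chi.
Proof.
apply: bisimilar_gen_root.
exact: (@sbisimilar_hom (system_of chi) (system_of chi) id _ _
  (fun x => esym (map_id _))).
Qed.
End FixedPoint.

Lemma sub_var_root (p : nat) (chi phi : cformula) (v : phi) :
  lab v = LVar p ->
  bisimilar (gen (inl v : sub_system p chi phi)) chi.
Proof.
move=> vp; apply: bisimilar_gen_root.
(* Every [p]-vertex is matched with the root of [chi], which it copies, and [chi] with itself. *)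
exists (fun x y => match x with
  | inl a => lab a = LVar p /\ y = root chi | inr b => y = b end).
split=> // -[a|b] y /=.
  move=> [-> ->]; rewrite eqxx; split=> // i li.
  by rewrite (nth_map (root chi)) ?succ_arity.
move=> ->; split=> // i li.
by rewrite (nth_map b) ?succ_arity.
Qed.

(** The only edges that change are those into [p]-vertices, which the quotient redirects to the
    root. The value at a [p]-vertex is [chi], the value at the root is [sub p chi psi], and the
    assumption equates the two. *)
Lemma sub_digamma_solution (p : nat) (chi psi : cformula)
    (modp : modalised p psi) :
  eqv (sub p chi psi) chi ->
  @solution (system_of (digamma modp))
    (fun w => gen (inl (val w) : sub_system p chi psi)).
Proof.
move=> fix_chi w; have wp := valP w.
apply: eqv_trans (CHL_bisim (bisimilar_gen_cnode _)) _.
rewrite /= (negPf wp); apply: eqv_cnode => i li.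
have si : i < size (succ (val w)) by rewrite succ_arity.
rewrite /dsucc (nth_map (val w)) // (nth_map (val w)) //.
move: (nth _ _ i) => u; have [up|up] := eqVneq (lab u) (LVar p).
  rewrite dproj_var //; apply: eqv_trans (eqv_sym fix_chi).
  exact/CHL_bisim/sub_var_root.
by rewrite dproj_nvar //; apply: eqv_refl.
Qed.

Theorem theorem3p7 (p : nat) (phi psi : cformula)
    (modphi : modalised p phi) (modpsi : modalised p psi) :
  CHL (ciff phi psi) -> CHL (ciff (digamma modphi) (digamma modpsi)).
Proof.
move=> phi_psi; set chi := digamma modphi.
have sub_phi : eqv (sub p chi phi) chi := CHL_bisim (bisimilar_sub_digamma _).
have sub_psi : eqv (sub p chi psi) chi.
  apply: eqv_trans sub_phi; apply: eqv_sym.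
  exact: CHL_iff_mp (sub_iff _ _ _ _) (CHL_sub p chi phi_psi).
apply: eqv_trans (eqv_sym sub_psi) _.
apply: eqv_trans (CHL_bisim (bisimilar_gen_digamma_root modpsi)).
(* At the root the first solution takes the value [sub p chi psi], the second the formula generated
   by the root of [digamma modpsi]. *)
exact: (solution_unique (sub_digamma_solution (modp := modpsi) sub_psi)
  (@gen_solution (system_of (digamma modpsi))) (droot modpsi)).
Qed.
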